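(* Let $(M^{2n+1},\phi,\xi,\eta,g)$ be an almost co-Kähler manifold that admits a $\beta$-almost Yamabe soliton with potential vector field $\xi$, i.e. there are a smooth function $\beta:M\to\mathbb{R}$ and a function $\lambda:M\to\mathbb{R}$ such that $\beta\,\mathcal{L}_{\xi}g=(\lambda-r)g$, where $r$ is the scalar curvature of $g$. Suppose that either $\beta>0$ on all of $M$ or $\beta<0$ on all of $M$. Then $M$ is a $K$-almost co-Kähler manifold.
   Context: An almost contact metric structure $(\phi,\xi,\eta,g)$ on a smooth $(2n+1)$-dimensional Riemannian manifold $(M,g)$ consists of a $(1,1)$-tensor field $\phi$, a unit vector field $\xi$ (the Reeb vector field) and a $1$-form $\eta$ with $\phi^2=-I+\eta\otimes\xi$, $\eta(\xi)=1$, $\phi\xi=0$, $\eta\circ\phi=0$, and $g(\phi X,\phi Y)=g(X,Y)-\eta(X)\eta(Y)$ for all vector fields $X,Y$ (so $g(X,\xi)=\eta(X)$). Put $\Phi(X,Y)=g(X,\phi Y)$. The manifold $(M^{2n+1},\phi,\xi,\eta,g)$ is almost co-Kähler if both the $1$-form $\eta$ and the $2$-form $\Phi$ are closed. An almost co-Kähler manifold is $K$-almost co-Kähler if $\xi$ is a Killing vector field. $\mathcal{L}$ denotes the Lie derivative. *)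

(* Defs.v *)
From HB Require Import structures.
From mathcomp Require Import all_boot all_order all_algebra.
From mathcomp Require Import ring.
From mathcomp Require Import boolp classical_sets functions reals.
From mathcomp Require Import topology normedtype derive.

Set Implicit Arguments.
Unset Strict Implicit.
Unset Printing Implicit Defensive.
Import Order.TTheory GRing.Theory Num.Theory.
Import numFieldNormedType.Exports.
Local Open Scope classical_set_scope.
Local Open Scope ring_scope.

(** * Smooth maps on open subsets of R^m *)

Lemma near_eq_continuous (T U : topologicalType) (f g : T -> U) (x : T) :
  (\forall y \near x, f y = g y) ->
  {for x, continuous f} -> {for x, continuous g}.
Proof.
move=> fg fc; rewrite /prop_for /continuous_at -(nbhs_singleton fg).
by apply: cvg_trans fc; exact: near_eq_cvg.
Qed.

Section Smooth.
Context {R : realType} {m : nat} {V : normedModType R}.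
Implicit Types (U : set 'rV[R]_m) (f g : 'rV[R]_m -> V).

(* [U] is meant to be open: continuity and derivability are those of [f] on a
   full neighbourhood of each point of [U]. *)
Fixpoint Ck (k : nat) U f : Prop :=
  (forall x, U x -> {for x, continuous f}) /\
  (if k is k'.+1 then
     forall i : 'I_m,
       (forall x, U x -> derivable f x (delta_mx 0 i)) /\
       Ck k' U ('D_(delta_mx 0 i) f)
   else True).

Definition smooth_on U f : Prop := forall k, Ck k U f.

Lemma Ck_cont k U f : Ck k U f -> forall x, U x -> {for x, continuous f}.
Proof. by case: k => [|k] []. Qed.

Lemma CkW k U f : Ck k.+1 U f -> Ck k U f.
Proof.
elim: k f => [|k IHk] f [fc fD]; first by split.
by split=> // i; have [? ?] := fD i; split=> //; exact: IHk.
Qed.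

Lemma eq_Ck k U f g : open U -> (forall x, U x -> f x = g x) ->
  Ck k U f -> Ck k U g.
Proof.
move=> oU; elim: k f g => [|k IHk] f g fg [fc fD]; have nfg x :
    U x -> \forall y \near x, f y = g y by
  move=> Ux; near=> y; apply: fg; near: y; exact: open_nbhs_nbhs.
  by split=> // x Ux; exact: near_eq_continuous (nfg x Ux) (fc x Ux).
split=> [x Ux|i]; first exact: near_eq_continuous (nfg x Ux) (fc x Ux).
have [fd fk] := fD i; split=> [x Ux|].
  exact: near_eq_derivable (nfg x Ux) (fd x Ux).
apply: IHk fk => x Ux; apply: near_eq_derive; exact: nfg.
Unshelve. all: by end_near. Qed.

Lemma Ck_cst k U (c : V) : Ck k U (cst c).
Proof.
elim: k c => [|k IHk] c; split => //; try by move=> x _; exact: cst_continuous.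
move=> i; split=> [x _|]; first exact: derivable_cst.
suff -> : 'D_(delta_mx 0 i) (cst c : 'rV[R]_m -> V) = cst 0 by exact: IHk.
by apply/funext => x; exact: derive_cst.
Qed.

Lemma CkB k U f g : open U -> Ck k U f -> Ck k U g -> Ck k U (f - g).
Proof.
move=> oU; elim: k f g => [|k IHk] f g [fc fD] [gc gD]; split=> //;
  try by move=> x Ux; apply: continuousB; [exact: fc|exact: gc].
move=> i; have [fd fk] := fD i; have [gd gk] := gD i; split=> [x Ux|].
  by apply: derivableB; [exact: fd|exact: gd].
apply: eq_Ck oU _ (IHk _ _ fk gk) => x Ux /=.
by rewrite deriveB //; [exact: fd|exact: gd].
Qed.

End Smooth.

Lemma CkM (R : realType) (m k : nat) (U : set 'rV[R]_m)
    (f g : 'rV[R]_m -> R^o) :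
  open U -> Ck k U f -> Ck k U g -> Ck k U (f * g).
Proof.
move=> oU; elim: k f g => [|k IHk] f g Ckf Ckg.
  split=> // x Ux; apply: (@continuousM R _ f g);
    [exact: (Ck_cont Ckf)|exact: (Ck_cont Ckg)].
split=> [x Ux|i].
  by apply: (@continuousM R _ f g); [exact: (Ck_cont Ckf)|exact: (Ck_cont Ckg)].
have [_ /(_ i)[fd fk]] := Ckf; have [_ /(_ i)[gd gk]] := Ckg.
split=> [x Ux|]; first by apply: derivableM; [exact: fd|exact: gd].
have H1 := IHk _ _ (CkW Ckf) gk.
have H2 := CkB oU (Ck_cst k U 0) (IHk _ _ (CkW Ckg) fk).
apply: eq_Ck oU _ (CkB oU H1 H2) => x Ux /=.
rewrite (@deriveM _ _ f g) //; [|exact: fd|exact: gd].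
by rewrite !fctE /= sub0r opprK.
Qed.

(** * Smooth manifolds (without boundary) *)

(* [chart_map] and [chart_inv] are total functions, meaningful only on
   [chart_dom] and on its image respectively. *)
Record chart (R : realType) (m : nat) (T : topologicalType) := Chart {
  chart_dom : set T;
  chart_map :> T -> 'rV[R]_m;
  chart_inv : 'rV[R]_m -> T;
  chart_dom_open : open chart_dom;
  chart_img_open : open (chart_map @` chart_dom);
  chart_mapK : forall p, chart_dom p -> chart_inv (chart_map p) = p;
  chart_map_cont : forall p, chart_dom p -> {for p, continuous chart_map};
  chart_inv_cont :
    forall x, (chart_map @` chart_dom) x -> {for x, continuous chart_inv} }.

(* An atlas, not necessarily maximal, determines the smooth structure. *)
Record smoothManifold (R : realType) (m : nat) := SmoothManifold {
  manifold_top :> topologicalType;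
  atlas : set (chart R m manifold_top);
  manifold_hausdorff : hausdorff_space manifold_top;
  manifold_second_countable : @second_countable manifold_top;
  atlas_cover : forall p, exists2 c, atlas c & chart_dom c p;
  atlas_compat : forall c d, atlas c -> atlas d ->
    smooth_on (c @` (chart_dom c `&` chart_dom d)) (d \o chart_inv c) }.

Section SmoothFun.
Context {R : realType} {m : nat} (M : smoothManifold R m).

Definition is_smooth (f : M -> R^o) : Prop :=
  forall c, atlas c -> smooth_on (c @` chart_dom c) (f \o chart_inv c).

Definition smooth_pred : {pred M -> R^o} := fun f => `[< is_smooth f >].

Record smooth_fun := SmoothFun {
  smooth_fun_val :> M -> R^o;
  smooth_funP : smooth_fun_val \in smooth_pred }.

HB.instance Definition _ := [isSub for smooth_fun_val].
HB.instance Definition _ := [Choice of smooth_fun by <:].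

Lemma is_smooth_cst (a : R) : is_smooth (cst a).
Proof. by move=> c _ k; exact: Ck_cst. Qed.

Lemma is_smoothB f g : is_smooth f -> is_smooth g -> is_smooth (f - g).
Proof.
by move=> sf sg c ac k; apply: CkB; [exact: chart_img_open|exact: sf|exact: sg].
Qed.

Lemma is_smoothM f g : is_smooth f -> is_smooth g -> is_smooth (f * g).
Proof.
by move=> sf sg c ac k; apply: (@CkM _ _ _ _ (f \o chart_inv c));
  [exact: chart_img_open|exact: sf|exact: sg].
Qed.

Lemma smooth_subring_closed : subring_closed smooth_pred.
Proof.
split=> [|f g /asboolP sf /asboolP sg|f g /asboolP sf /asboolP sg];
  apply/asboolP.
- exact: is_smooth_cst.
- exact: is_smoothB.
- exact: is_smoothM.
Qed.

HB.instance Definition _ :=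
  GRing.isSubringClosed.Build _ smooth_pred smooth_subring_closed.
HB.instance Definition _ := GRing.SubChoice_isSubComPzRing.Build _ _ smooth_fun
  (GRing.subringClosedP smooth_pred).

Lemma smooth_scaler_closed : scaler_closed smooth_pred.
Proof.
move=> a f /asboolP sf; apply/asboolP.
exact: (is_smoothM (is_smooth_cst a) sf).
Qed.

HB.instance Definition _ :=
  GRing.isScaleClosed.Build _ _ smooth_pred smooth_scaler_closed.
HB.instance Definition _ := [SubZmodule_isSubLmodule of smooth_fun by <:].

Definition mk_smooth (f : M -> R^o) (sf : is_smooth f) : smooth_fun :=
  SmoothFun (asboolT sf).

Lemma smooth_is_smooth (f : smooth_fun) : is_smooth f.
Proof. exact/asboolP/smooth_funP. Qed.

End SmoothFun.

(** * Tangent vectors and vector fields *)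

Section Tangent.
Context {R : realType} {m : nat} {M : smoothManifold R m}.

(* Tangent vectors at [p] are the derivations at [p] of the algebra C^oo(M). *)
Definition derivation_at (p : M) : {pred smooth_fun M -> R^o} := fun v =>
  `[< linear v /\
     forall f g : smooth_fun M, v (f * g) = f p * v g + g p * v f >].

Record tangent (p : M) := Tangent {
  tangent_val :> smooth_fun M -> R^o;
  tangentP : tangent_val \in derivation_at p }.

HB.instance Definition _ p := [isSub for (@tangent_val p)].
HB.instance Definition _ p := [Choice of tangent p by <:].

Lemma derivation_submod_closed p : submod_closed (derivation_at p).
Proof.
split.
  apply/asboolP; split=> [a f g|f g]; rewrite /GRing.zero /=.
    by rewrite scaler0 addr0.
  by rewrite !mulr0 addr0.
move=> a v w /asboolP[vl vL] /asboolP[wl wL]; apply/asboolP.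
split=> [b f g|f g]; rewrite !fctE /=.
  by rewrite vl wl !scalerDr !scalerA addrACA (mulrC a).
by rewrite vL wL !scalerDr !mulrDr addrACA -!scalerAr.
Qed.

HB.instance Definition _ p :=
  GRing.isSubmodClosed.Build _ _ (derivation_at p) (derivation_submod_closed p).
HB.instance Definition _ p := [SubChoice_isSubLmodule of tangent p by <:].

Record vfield := VField {
  vf_at :> forall p : M, tangent p;
  vf_smooth : forall f : smooth_fun M, is_smooth (fun p => vf_at p f) }.

(* X f *)
Definition vf_app (X : vfield) (f : smooth_fun M) : smooth_fun M :=
  mk_smooth (vf_smooth X f).

Lemma tangentD p (v : tangent p) f g : v (f + g) = v f + v g.
Proof.
by have /asboolP[vl _] := tangentP v; have := vl 1 f g; rewrite !scale1r.
Qed.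

Lemma tangentL p (v : tangent p) : linear v.
Proof. by have /asboolP[] := tangentP v. Qed.

Lemma tangentM p (v : tangent p) (f g : smooth_fun M) :
  v (f * g) = f p * v g + g p * v f.
Proof. by have /asboolP[_ ->] := tangentP v. Qed.

Lemma vf_app_linear (X : vfield) : linear (vf_app X).
Proof.
by move=> a f g; apply/val_inj/funext => p; exact: tangentL.
Qed.

Lemma vf_appM (X : vfield) (f g : smooth_fun M) :
  vf_app X (f * g) = f * vf_app X g + g * vf_app X f.
Proof. by apply/val_inj/funext => p; exact: tangentM. Qed.

Definition bracket_val (X Y : vfield) (p : M) : smooth_fun M -> R^o :=
  fun f => X p (vf_app Y f) - Y p (vf_app X f).

Lemma bracket_subproof (X Y : vfield) (p : M) :
  bracket_val X Y p \in derivation_at p.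
Proof.
apply/asboolP; rewrite /bracket_val; split=> [a f g|f g].
  by rewrite !vf_app_linear !tangentL scalerBr opprD addrACA.
rewrite !vf_appM !tangentD !tangentM /= !mulrBr.
ring.
Qed.

(* The Lie bracket: [X, Y] f = X (Y f) - Y (X f). *)
Lemma bracket_smooth (X Y : vfield) (f : smooth_fun M) :
  is_smooth (fun p => Tangent (bracket_subproof X Y p) f).
Proof.
exact: smooth_is_smooth (vf_app X (vf_app Y f) - vf_app Y (vf_app X f)).
Qed.

Definition bracket (X Y : vfield) : vfield := VField (bracket_smooth X Y).

Lemma vf_add_smooth (X Y : vfield) (f : smooth_fun M) :
  is_smooth (fun p => (X p + Y p) f).
Proof.
rewrite (_ : (fun p => _) = vf_app X f + vf_app Y f); last exact/funext.
exact: smooth_is_smooth (vf_app X f + vf_app Y f).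
Qed.

Definition vf_add (X Y : vfield) : vfield := VField (vf_add_smooth X Y).

Lemma vf_scale_smooth (h : smooth_fun M) (X : vfield) (f : smooth_fun M) :
  is_smooth (fun p => (h p *: X p) f).
Proof. exact: smooth_is_smooth (h * vf_app X f). Qed.

Definition vf_scale (h : smooth_fun M) (X : vfield) : vfield :=
  VField (vf_scale_smooth h X).

End Tangent.
Arguments vfield {R m} M.

(** * Riemannian metrics *)

(* A covariant tensor is smooth when its values on all smooth vector fields
   are smooth functions. *)
Record riemannianMetric (R : realType) (m : nat) (M : smoothManifold R m) :=
  RiemannianMetric {
  metric_at : forall p : M, tangent p -> tangent p -> R;
  metric_linear : forall p (w : tangent p),
    scalar (fun v => metric_at v w : R^o);
  metric_atC : forall p (v w : tangent p), metric_at v w = metric_at w v;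
  metric_pos : forall p (v : tangent p), v != 0 -> 0 < metric_at v v;
  metric_smooth : forall X Y : vfield M,
    is_smooth (fun p => metric_at (X p) (Y p)) }.

Arguments metric_at {R m M} g {p} : rename.

Section Riemannian.
Context {R : realType} {m : nat} {M : smoothManifold R m}.
Variable g : riemannianMetric M.

Definition metric_app (X Y : vfield M) : smooth_fun M :=
  mk_smooth (metric_smooth g X Y).

(* (L_V g)(X, Y) *)
Definition lie_metric (V X Y : vfield M) : smooth_fun M :=
  vf_app V (metric_app X Y)
  - metric_app (bracket V X) Y - metric_app X (bracket V Y).

Definition killing (V : vfield M) : Prop := forall X Y, lie_metric V X Y = 0.

Record levi_civita (nabla : vfield M -> vfield M -> vfield M) : Prop := {
  nabla_addl : forall X Y Z,
    nabla (vf_add X Y) Z = vf_add (nabla X Z) (nabla Y Z);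
  nabla_scalel : forall f X Y, nabla (vf_scale f X) Y = vf_scale f (nabla X Y);
  nabla_addr : forall X Y Z,
    nabla X (vf_add Y Z) = vf_add (nabla X Y) (nabla X Z);
  nabla_leibniz : forall f X Y,
    nabla X (vf_scale f Y) = vf_add (vf_scale (vf_app X f) Y)
                                    (vf_scale f (nabla X Y));
  nabla_torsion_free : forall X Y (p : M),
    nabla X Y p - nabla Y X p = bracket X Y p;
  nabla_metric : forall X Y Z,
    vf_app X (metric_app Y Z) =
      metric_app (nabla X Y) Z + metric_app Y (nabla X Z) }.

(* R(X, Y) Z at p *)
Definition curvature nabla (X Y Z : vfield M) (p : M) : tangent p :=
  nabla X (nabla Y Z) p - nabla Y (nabla X Z) p - nabla (bracket X Y) Z p.

(* As m = dim M, this says that (E_i(p)) is an orthonormal basis of T_p M. *)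
Definition orthonormal_at (p : M) (E : 'I_m -> vfield M) : Prop :=
  forall i j, metric_at g (E i p) (E j p) = (i == j)%:R.

(* Ric(Y, Z) = trace (X |-> R(X, Y) Z), computed in the frame E *)
Definition ricci nabla (E : 'I_m -> vfield M) (Y Z : vfield M) (p : M) : R :=
  \sum_i metric_at g (curvature nabla (E i) Y Z p) (E i p).

(* The scalar curvature at [p] is the metric trace of Ric, defined here as the
   value given by the Levi-Civita connection of [g] and any vector fields that
   are orthonormal at [p]; [xget] merely selects this unique value. *)
Definition scalar_curvature (p : M) : R :=
  xget 0 [set s | exists nabla E,
    [/\ levi_civita nabla, orthonormal_at p E
      & s = \sum_j ricci nabla E (E j) (E j) p]].

(* beta L_V g = (lambda - r) g *)
Definition almost_yamabe_soliton (beta : smooth_fun M) (lambda : M -> R)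
    (V : vfield M) : Prop :=
  forall (X Y : vfield M) (p : M),
    beta p * lie_metric V X Y p =
    (lambda p - scalar_curvature p) * metric_at g (X p) (Y p).

End Riemannian.

(** * Differential forms, in terms of their values on vector fields *)

Section Forms.
Context {R : realType} {m : nat} {M : smoothManifold R m}.

(* Up to a constant factor depending on the convention, the exterior
   derivatives of a 1-form and of a 2-form. *)
Definition d1 (w : vfield M -> smooth_fun M) (X Y : vfield M) : smooth_fun M :=
  vf_app X (w Y) - vf_app Y (w X) - w (bracket X Y).

Definition d2 (w : vfield M -> vfield M -> smooth_fun M) (X Y Z : vfield M) :
    smooth_fun M :=
  vf_app X (w Y Z) + vf_app Y (w Z X) + vf_app Z (w X Y)
  - w (bracket X Y) Z - w (bracket Y Z) X - w (bracket Z X) Y.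

End Forms.

(** * Almost contact metric structures *)

Record almostContactMetric (R : realType) (m : nat) (M : smoothManifold R m)
    (g : riemannianMetric M) := AlmostContactMetric {
  ac_phi : forall p : M, tangent p -> tangent p;
  reeb : vfield M;
  ac_eta : forall p : M, tangent p -> R;
  ac_phi_linear : forall p, linear (@ac_phi p);
  ac_phi_smooth : forall (X : vfield M) (f : smooth_fun M),
    is_smooth (fun p => ac_phi (X p) f);
  ac_eta_linear : forall p, scalar (@ac_eta p : tangent p -> R^o);
  ac_eta_smooth : forall X : vfield M, is_smooth (fun p => ac_eta (X p));
  reeb_unit : forall p, metric_at g (reeb p) (reeb p) = 1;
  ac_phi2 : forall p (v : tangent p),
    ac_phi (ac_phi v) = - v + ac_eta v *: reeb p;
  ac_eta_reeb : forall p, ac_eta (reeb p) = 1;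
  ac_phi_reeb : forall p, ac_phi (reeb p) = 0;
  ac_eta_phi : forall p (v : tangent p), ac_eta (ac_phi v) = 0;
  ac_metric : forall p (v w : tangent p),
    metric_at g (ac_phi v) (ac_phi w) =
      metric_at g v w - ac_eta v * ac_eta w }.

Section AlmostContact.
Context {R : realType} {m : nat} {M : smoothManifold R m}.
Context {g : riemannianMetric M}.
Variable S : almostContactMetric g.

Definition phi_app (X : vfield M) : vfield M := VField (ac_phi_smooth S X).

Definition eta_form (X : vfield M) : smooth_fun M :=
  mk_smooth (ac_eta_smooth S X).

(* Phi(X, Y) = g(X, phi Y) *)
Definition fundamental_form (X Y : vfield M) : smooth_fun M :=
  metric_app g X (phi_app Y).

Definition almost_coKahler : Prop :=
  (forall X Y, d1 eta_form X Y = 0) /\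
  (forall X Y Z, d2 fundamental_form X Y Z = 0).

Definition K_almost_coKahler : Prop :=
  almost_coKahler /\ killing g (reeb S).

End AlmostContact.

(* Main.v *)
Require Import Defs.
From mathcomp Require Import all_boot all_order all_algebra.
From mathcomp Require Import boolp.
From mathcomp Require Import reals topology normedtype.
Import Order.TTheory GRing.Theory Num.Theory.
Local Open Scope ring_scope.

(** The soliton equation says that [L_xi g] is, where [beta] does not vanish,
    a pointwise multiple of [g]. Such a multiple is detected by any single
    nonzero vector, and [xi] itself is a vector on which [L_xi g] is known:
    for a field [V] of constant length,
    [(L_V g)(V, V) = V (g(V, V)) - 2 g([V, V], V) = 0], the first term being
    the derivative of a constant and [[V, V]] being zero
    ([lie_metric_diag_unit]). As [g(xi, xi) = 1], evaluating the soliton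
    equation on [(xi, xi)] gives [lambda = r] at every point, so that
    [beta L_xi g = 0] identically, and dividing by [beta] shows that [xi] is
    Killing. *)

Lemma tangent1 (R : realType) (m : nat) (M : smoothManifold R m) (p : M)
    (v : tangent p) : v 1 = 0.
Proof.
have := tangentM v 1 1; rewrite mulr1 !mul1r => /eqP.
by rewrite -subr_eq0 opprD addNKr oppr_eq0 => /eqP.
Qed.

Lemma bracket_self (R : realType) (m : nat) (M : smoothManifold R m)
    (X : vfield M) (p : M) : bracket X X p = 0.
Proof. by apply/val_inj/funext => f; exact: subrr. Qed.

Lemma metric_at0l (R : realType) (m : nat) (M : smoothManifold R m)
    (g : riemannianMetric M) (p : M) (w : tangent p) : metric_at g 0 w = 0.
Proof.
have := metric_linear g w (-1) 0 0.
by rewrite scaler0 addr0 mulN1r addNr.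
Qed.

Lemma lie_metric_diag_unit (R : realType) (m : nat) (M : smoothManifold R m)
    (g : riemannianMetric M) (V : vfield M) (p : M) :
  (forall q : M, metric_at g (V q) (V q) = 1) -> lie_metric g V V V p = 0.
Proof.
move=> V1; have gVV : metric_app g V V = 1 by apply/val_inj/funext => q; exact: V1.
have -> : lie_metric g V V V p = V p (metric_app g V V)
    - metric_at g (bracket V V p) (V p) - metric_at g (V p) (bracket V V p).
  by [].
by rewrite gVV tangent1 bracket_self (metric_atC g (V p)) metric_at0l !subr0.
Qed.

(** The soliton equation on the pair [(V, V)] reads [0 = lambda - r], so the
    conformal factor of [L_V g] is zero; on any other pair of fields it then
    reads [beta L_V g = 0]. *)
Lemma almost_yamabe_unit_killing (R : realType) (m : nat)
    (M : smoothManifold R m) (g : riemannianMetric M) (V : vfield M)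
    (beta : smooth_fun M) (lambda : M -> R) :
  (forall p : M, metric_at g (V p) (V p) = 1) ->
  (forall p : M, beta p != 0) ->
  almost_yamabe_soliton g beta lambda V -> killing g V.
Proof.
move=> V1 beta0 solV X Y; apply/val_inj/funext => p.
have lr0 : lambda p - scalar_curvature g p = 0.
  by have := solV V V p; rewrite lie_metric_diag_unit // mulr0 V1 mulr1.
have /eqP := solV X Y p.
by rewrite lr0 mul0r mulf_eq0 (negbTE (beta0 p)) => /eqP.
Qed.

Theorem theorem3p1 (R : realType) (n : nat) (M : smoothManifold R n.*2.+1)
    (g : riemannianMetric M) (S : almostContactMetric g)
    (beta : smooth_fun M) (lambda : M -> R) :
  almost_coKahler S ->
  almost_yamabe_soliton g beta lambda (reeb S) ->
  (forall p : M, 0 < beta p) \/ (forall p : M, beta p < 0) ->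
  K_almost_coKahler S.
Proof.
move=> coK sol beta_sign; split=> //.
apply: almost_yamabe_unit_killing sol => p; first exact: reeb_unit.
by case: beta_sign => /(_ p); [exact: lt0r_neq0 | exact: ltr0_neq0].
Qed.
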